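(* Let $T>0$, let $q\in L^\infty(0,1)$ (real-valued), $a\in L^\infty[0,T]$ with $a(t)\ge a_0>0$ on $[0,T]$, and $u_0\in L^2(0,1)$ with $u_0''\in L^2(0,1)$. Let $u\in C([0,T];L^2(0,1))$ be the unique classical solution of $$\partial_tu+a(t)\big(-\partial_x^2u+q(x)u\big)=0 \text{ on }[0,T]\times(0,1),\quad u(0,x)=u_0(x),\quad u(t,0)=0=u(t,1).$$ Then for any families $q_\varepsilon$, $a_\varepsilon$, $u_{0,\varepsilon}$ with $\|u_0-u_{0,\varepsilon}\|_{L^2}\to0$, $\|q-q_\varepsilon\|_{L^\infty}\to0$ and $\|a-a_\varepsilon\|_{L^\infty[0,T]}\to0$ as $\varepsilon\to0$, any representative $(u_\varepsilon)$ of the very weak solution, i.e. $u_\varepsilon$ solving $\partial_tu_\varepsilon+a_\varepsilon(t)(-\partial_x^2u_\varepsilon+q_\varepsilon(x)u_\varepsilon)=0$, $u_\varepsilon(0,\cdot)=u_{0,\varepsilon}$, $u_\varepsilon(t,0)=0=u_\varepsilon(t,1)$, satisfies $$\sup_{0\le t\le T}\|u(t,\cdot)-u_\varepsilon(t,\cdot)\|_{L^2}\to0\quad\text{as }\varepsilon\to0.$$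
   Context: The classical solution is the one given by the well-posedness theory for $q\in L^\infty$, $a\in L^\infty$, $a\ge a_0>0$: $u(t,x)=\sum_n B_ne^{-\lambda_n\int_0^ta(\tau)d\tau}\phi_n(x)$ with $\lambda_n,\phi_n$ the Dirichlet eigenvalues and orthonormal eigenfunctions of $-\frac{d^2}{dx^2}+q$ on $(0,1)$ and $B_n=\int_0^1u_0\phi_n$. *)

(* Defs.v *)
From HB Require Import structures.
From mathcomp Require Import all_boot all_order all_algebra.
From mathcomp Require Import all_classical all_reals all_analysis.
Set Implicit Arguments. Unset Strict Implicit. Unset Printing Implicit Defensive.
Import Order.TTheory GRing.Theory Num.Theory.
Import numFieldNormedType.Exports.
Local Open Scope classical_set_scope.
Local Open Scope ring_scope.

Section Defs.
Variable R : realType.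
Local Notation mu := (@lebesgue_measure R).

Definition L2sq (L : R) (f : R -> R) : \bar R :=
  let D := `[0, L]%classic in (\int[mu]_(x in D) ((f x) ^+ 2)%:E)%E.

Definition in_L2 (L : R) (f : R -> R) : Prop :=
  measurable_fun `[0, L] f /\ (L2sq L f < +oo)%E.

Definition in_Linf (L : R) (f : R -> R) : Prop :=
  measurable_fun `[0, L] f /\
  exists M : R, {ae mu, forall x : R, `[0, L]%classic x -> `|f x| <= M}.

(* f is in H^2(0,1), i.e. f in L^2 and its distributional second
   derivative g is in L^2: f = c0 + c1 x + int_0^x int_0^y g  a.e. *)
Definition in_H2 (f : R -> R) : Prop :=
  exists (g : R -> R) (c0 c1 : R), in_L2 1 g /\
  {ae mu, forall x : R, `[0, 1]%classic x ->
     f x = c0 + c1 * x +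
       Rintegral mu `[0, x] (fun y => Rintegral mu `[0, y] g)}.

(* (lam n, phi n)_n is a complete orthonormal system of Dirichlet
   eigenpairs of -d^2/dx^2 + q on (0,1):
   phi n continuous on [0,1], phi n (0) = 0 = phi n (1),
   phi n'' = (q - lam n) phi n (in integrated form, phi n in W^{2,1}),
   orthonormal in L^2(0,1), and an orthonormal basis of L^2(0,1). *)
Definition dirichlet_eigensystem (q : R -> R) (lam : nat -> R)
    (phi : nat -> R -> R) : Prop :=
  (forall n, {within `[0, 1], continuous (phi n)}) /\
  (forall n, exists c : R, forall x : R, `[0, 1]%classic x ->
     phi n x = c * x + Rintegral mu `[0, x]
        (fun y => Rintegral mu `[0, y] (fun z => (q z - lam n) * phi n z))) /\
  (forall n, phi n 1 = 0) /\
  (forall n m, Rintegral mu `[0, 1] (fun x => phi n x * phi m x)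
               = (n == m)%:R) /\
  (forall f, in_L2 1 f ->
     (fun N => L2sq 1 (fun x => f x - \sum_(k < N)
         Rintegral mu `[0, 1] (fun y => f y * phi k y) * phi k x))
     @ \oo --> 0%E).

(* u is the classical solution on [0,T] of
   u_t + a(t)(-u_xx + q u) = 0, u(0) = u0, Dirichlet boundary conditions,
   given by u(t) = sum_n B_n exp(-lam_n int_0^t a) phi_n (series in L^2). *)
Definition classical_solution (T : R) (q a u0 : R -> R)
    (u : R -> R -> R) : Prop :=
  exists (lam : nat -> R) (phi : nat -> R -> R),
    dirichlet_eigensystem q lam phi /\
    forall t : R, `[0, T]%classic t ->
      measurable_fun `[0, 1 : R] (u t) /\
      (fun N => L2sq 1 (fun x => u t x - \sum_(k < N)
          Rintegral mu `[0, 1] (fun y => u0 y * phi k y) *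
          expR (- lam k * Rintegral mu `[0, t] a) * phi k x))
      @ \oo --> 0%E.

End Defs.

(* Main.v *)
Require Import Defs.
From HB Require Import structures.
From mathcomp Require Import all_boot all_order all_algebra.
From mathcomp Require Import all_classical all_reals all_analysis.
From mathcomp Require Import measurable_realfun.
From mathcomp Require Import ring lra.
Set Implicit Arguments. Unset Strict Implicit. Unset Printing Implicit Defensive.
Import Order.TTheory GRing.Theory Num.Theory.
Import numFieldNormedType.Exports.
Local Open Scope classical_set_scope.
Local Open Scope ring_scope.

(* Both solutions are L^2-limits of finite eigenfunction sums, so it suffices to
   compare a fixed finite sum p for (q, a) with a finite sum v for (q', a').  For
   a fixed t, rescale the two exponential flows so that both run over s in [0, 1]
   with speeds al = \int_0^t a and be = \int_0^t a'.  The difference w = p - v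
   lies in H^2 with Dirichlet boundary values, whence \int w w'' <= 0, and
     d/ds |w|^2 <= (2 be M + 1) |w|^2 + ((be |q - q'|_oo + |be - al|) P)^2,
   where P bounds p and (-d^2/dx^2 + q) p.  Gronwall's inequality gives an
   estimate which does not depend on the number of terms of v; with p = 0 it also
   controls the remainder of the series of u uniformly in t. *)

(** * Real-valued integrals: almost everywhere comparison and finite sums *)

Section ae_Rintegral.
Context d (X : measurableType d) (R : realType).
Variable mu : {measure set X -> \bar R}.
Implicit Types (D : set X) (f g : X -> R).

(** The positive part of [f] is nonnegative at every point and agrees with [f] almost everywhere on
    [D], so it has the same integral. *)
Lemma ae_ge0_Rintegral D f : measurable D -> measurable_fun D f ->
  {ae mu, forall x, D x -> 0 <= f x} -> 0 <= \int[mu]_(x in D) f x.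
Proof.
move=> mD mf f0.
rewrite /Rintegral (@ae_eq_integral _ _ _ mu D (fun x => (Num.max (f x) 0)%:E)) //.
- by apply: Rintegral_ge0 => x _; rewrite le_max lexx orbT.
- exact/measurable_EFinP.
- by apply/measurable_EFinP; exact: measurable_maxr.
- by apply: filterS f0 => x h Dx; rewrite max_l// h.
Qed.

Lemma ae_le_Rintegral D f g : measurable D ->
  mu.-integrable D (EFin \o f) -> mu.-integrable D (EFin \o g) ->
  {ae mu, forall x, D x -> f x <= g x} ->
  \int[mu]_(x in D) f x <= \int[mu]_(x in D) g x.
Proof.
move=> mD intf intg fg; rewrite -subr_ge0 -RintegralB//.
apply: ae_ge0_Rintegral => //.
- by apply: measurable_funB;
    apply/measurable_EFinP; [move/integrableP : intg => []|move/integrableP : intf => []].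
- by apply: filterS fg => x h Dx; rewrite subr_ge0 h.
Qed.

Lemma Rintegral_sum D (I : Type) (s : seq I) (P : pred I) (h : I -> X -> R) :
  measurable D -> (forall i, mu.-integrable D (EFin \o h i)) ->
  \int[mu]_(x in D) (\sum_(i <- s | P i) h i x) =
  \sum_(i <- s | P i) \int[mu]_(x in D) h i x.
Proof.
move=> mD inth; elim: s => [|i s IHs].
  under eq_Rintegral do rewrite big_nil; rewrite big_nil.
  by rewrite Rintegral_cst// mul0r.
under eq_Rintegral do rewrite big_cons; rewrite big_cons.
case: ifPn => // Pi; rewrite RintegralD// ?IHs//.
rewrite (_ : EFin \o _ =
  (fun x => \sum_(j <- s | P j) (EFin \o h j) x)%E); last first.
  by apply/funext => x; rewrite /= sumEFin.
exact: integrable_sum.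
Qed.

End ae_Rintegral.

(** * Essentially bounded functions on a bounded interval *)

Section essentially_bounded.
Variable R : realType.
Local Notation mu := (@lebesgue_measure R).
Implicit Types (L : R) (f g : R -> R).

#[global] Instance lebesgue_ae_filter : Filter (nbhs (almost_everywhere mu)) :=
  ae_filter_ringOfSetsType mu.

Lemma in_Linf_cst L (c : R) : in_Linf L (fun=> c).
Proof. by split=> //; exists `|c|; apply: aeW. Qed.

Lemma in_LinfD L f g : in_Linf L f -> in_Linf L g ->
  in_Linf L (fun x => f x + g x).
Proof.
move=> [mf [A fA]] [mg [B gB]]; split; first exact: measurable_funD.
exists (A + B); apply: filterS2 fA gB => x fA gB Lx.
by rewrite (le_trans (ler_normD _ _))// lerD ?fA ?gB.
Qed.

Lemma in_LinfM L f g : in_Linf L f -> in_Linf L g ->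
  in_Linf L (fun x => f x * g x).
Proof.
move=> [mf [A fA]] [mg [B gB]]; split; first exact: measurable_funM.
exists (A * B); apply: filterS2 fA gB => x fA gB Lx.
by rewrite normrM ler_pM ?fA ?gB.
Qed.

Lemma in_LinfZ L (c : R) f : in_Linf L f -> in_Linf L (fun x => c * f x).
Proof. exact/in_LinfM/in_Linf_cst. Qed.

Lemma in_LinfB L f g : in_Linf L f -> in_Linf L g ->
  in_Linf L (fun x => f x - g x).
Proof.
move=> Lf /(in_LinfZ (-1)) Lg.
rewrite (_ : (fun x => _) = (fun x => f x + -1 * g x)); first exact: in_LinfD.
by apply/funext => x; rewrite mulN1r.
Qed.

Lemma in_Linf_sum L (I : Type) (s : seq I) (h : I -> R -> R) :
  (forall i, in_Linf L (h i)) -> in_Linf L (fun x => \sum_(i <- s) h i x).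
Proof.
move=> Lh; elim: s => [|i s IHs].
  by under [X in in_Linf _ X]eq_fun do rewrite big_nil; exact: in_Linf_cst.
by under [X in in_Linf _ X]eq_fun do rewrite big_cons; exact: in_LinfD.
Qed.

Lemma in_Linf_integrable L f : in_Linf L f ->
  mu.-integrable `[0, L] (EFin \o f).
Proof.
have mD : measurable (`[0, L]%classic : set R) by [].
move=> [mf [A fA]]; apply/integrableP; split; first exact/measurable_EFinP.
have mEf : measurable_fun (`[0, L]%classic : set R) (EFin \o f).
  exact/measurable_EFinP.
have A0 : (0 <= (`|A|%R)%:E)%E by rewrite lee_fin.
have Abound := @integral_le_bound _ _ _ mu _ _ _ mD mEf A0.
apply: le_lt_trans (Abound _) _.
  by apply: filterS fA => x h Lx; rewrite lee_fin (le_trans (h Lx))// ler_norm.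
(* The sign of [L] is arbitrary: the interval has measure [L] when [L] is positive and 0 otherwise,
   finite in both cases. *)
rewrite lte_mul_pinfty//= lebesgue_measure_itv/=.
by case: ifPn => // _; rewrite -EFinB ltry.
Qed.

Lemma continuous_bounded_itv L f : {within `[0, L], continuous f} ->
  exists M, forall x, `[0, L]%classic x -> `|f x| <= M.
Proof.
move=> cf.
have /compact_bounded[M [_ Mf]] := continuous_compact cf (@segment_compact _ 0 L).
(* Compactness yields a bound by every number strictly above [M], hence the added 1. *)
exists (`|M| + 1) => x Lx; apply: Mf; last by exists x.
by rewrite (le_lt_trans (ler_norm _))// ltrDl.
Qed.

Lemma continuous_in_Linf L f : {within `[0, L], continuous f} -> in_Linf L f.
Proof.
move=> cf; split; first exact: subspace_continuous_measurable_fun.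
by have [M fM] := continuous_bounded_itv cf; exists M; apply: aeW.
Qed.

End essentially_bounded.

(** * Fubini for a product integrand restricted to a measurable set *)

Section kernel_swap.
Context d1 d2 (X : measurableType d1) (Y : measurableType d2) (R : realType).
Variables (m1 : {sigma_finite_measure set X -> \bar R})
          (m2 : {sigma_finite_measure set Y -> \bar R}).

Lemma integrable_EFin_Rintegral d (T : measurableType d)
    (m : {measure set T -> \bar R}) (D : set T) (f : T -> R) : measurable D ->
  m.-integrable D (EFin \o f) ->
  (\int[m]_(x in D) (f x)%:E)%E = (\int[m]_(x in D) f x)%:E.
Proof. by move=> mD intf; rewrite /Rintegral fineK//; exact: integrable_fin_num. Qed.

(** The integrand h(x) g(y) 1_A(x, y) is dominated by |h(x)| |g(y)|, whose iterated integral is a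
    product of two finite numbers. Fubini therefore applies, and the factor that is constant in the
    inner variable is pulled out on each side. *)
Lemma Rintegral_swap (A : set (X * Y)) (h : X -> R) (g : Y -> R) :
  measurable A ->
  m1.-integrable setT (EFin \o h) -> m2.-integrable setT (EFin \o g) ->
  \int[m1]_x (h x * \int[m2]_y (g y * \1_A (x, y))) =
  \int[m2]_y (g y * \int[m1]_x (h x * \1_A (x, y))).
Proof.
move=> mA inth intg.
have mh : measurable_fun setT h.
  by apply/measurable_EFinP; case/integrableP : inth.
have mg : measurable_fun setT g.
  by apply/measurable_EFinP; case/integrableP : intg.
pose F (z : X * Y) : \bar R := (h z.1 * g z.2 * \1_A z)%:E.
have mF : measurable_fun setT F.
  apply/measurable_EFinP/measurable_funM; first apply: measurable_funM.
  - exact: measurableT_comp.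
  - exact: measurableT_comp.
  - exact: measurable_indic.
have intF : (m1 \x m2)%E.-integrable setT F.
  apply/(integrable12ltyP m1 m2 mF).
  apply: (@le_lt_trans _ _ (\int[m1]_x (`|h x|%:E * (\int[m2]_y `|g y|%:E)))%E).
    apply: ge0_le_integral => //.
    - by move=> x _; exact: integral_ge0.
    - apply: (@measurable_fun_fubini_tonelli_F _ _ _ _ _ m2 (abse \o F)) => //.
        exact: measurableT_comp.
      by move=> z; exact: abse_ge0.
    - apply: emeasurable_funM => //.
      by apply/measurable_EFinP; exact: measurableT_comp.
    - move=> x _; rewrite -ge0_integralZl//.
      + apply: ge0_le_integral => //.
        * apply/measurableT_comp => //; exact: measurableT_comp mF _.
        * apply: measurable_funeM; apply/measurable_EFinP.
          exact: measurableT_comp.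
        * move=> y _; rewrite /F/= lee_fin !normrM -[leRHS]mulr1.
          by rewrite ler_pM// ?mulr_ge0// indicE ger0_norm// lern1 leq_b1.
      + by apply/measurable_EFinP; exact: measurableT_comp.
  have [_ ih] := integrableP _ _ _ inth.
  have [_ ig] := integrableP _ _ _ intg.
  rewrite ge0_integralZr//.
  - rewrite lte_mul_pinfty// ?integral_ge0// ge0_fin_numE//.
    by rewrite integral_ge0.
  - by apply/measurable_EFinP; exact: measurableT_comp.
  - by rewrite integral_ge0.
have indic1 z : `|\1_A z : R| <= 1 by rewrite indicE ger0_norm// lern1 leq_b1.
have mx x : measurable_fun setT (fun y => \1_A (x, y) : R).
  by apply: measurableT_comp; [exact: measurable_indic|exact: measurable_pair1].
have my y : measurable_fun setT (fun x => \1_A (x, y) : R).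
  by apply: measurableT_comp; [exact: measurable_indic|exact: measurable_pair2].
have intx x : m2.-integrable setT (EFin \o (fun y => g y * \1_A (x, y))).
  apply: le_integrable intg => //; first exact/measurable_EFinP/measurable_funM.
  by move=> y _; rewrite /= lee_fin normrM ler_piMr.
have inty y : m1.-integrable setT (EFin \o (fun x => h x * \1_A (x, y))).
  apply: le_integrable inth => //; first exact/measurable_EFinP/measurable_funM.
  by move=> x _; rewrite /= lee_fin normrM ler_piMr.
have := Fubini intF; rewrite /Rintegral => FE; congr fine.
transitivity (\int[m1]_x \int[m2]_y F (x, y))%E.
  apply: eq_integral => x _.
  rewrite EFinM -integrable_EFin_Rintegral// -integralZl//; last exact: intx.
  by apply: eq_integral => y _; rewrite /F/= -mulrA EFinM.
rewrite FE; apply: eq_integral => y _.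
rewrite EFinM -integrable_EFin_Rintegral// -integralZl//; last exact: inty.
by apply: eq_integral => x _; rewrite /F/= mulrAC mulrC EFinM.
Qed.

End kernel_swap.

(** * Nonpositivity of the Dirichlet form *)

Section dirichlet_form.
Variable R : realType.
Local Notation mu := (@lebesgue_measure R).
Implicit Types (L : R) (f g h : R -> R).

(** Fubini over the triangle y <= x of [0, L]^2. The inner integral of [h] over [y, L] is written
    with primitives starting at 0, the shape in which w' appears in the integration by parts. *)
Lemma Rintegral_swap_triangle L h g :
  mu.-integrable `[0, L] (EFin \o h) -> mu.-integrable `[0, L] (EFin \o g) ->
  \int[mu]_(x in `[0, L]) (h x * \int[mu]_(y in `[0, x]) g y) =
  \int[mu]_(y in `[0, L]) (g y * (\int[mu]_(x in `[0, L]) h x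
                                  - \int[mu]_(x in `[0, y]) h x)).
Proof.
move=> inth intg; set D := `[0, L]%classic.
have mD : measurable D by exact: measurable_itv.
(* Extending both functions by zero moves the integrals to the whole line, where the general swap is
   stated. *)
have inth0 : mu.-integrable setT (EFin \o (h \_ D)).
  have := (@integrable_mkcond _ _ _ mu D (EFin \o h) mD).1 inth.
  by rewrite restrict_EFin.
have intg0 : mu.-integrable setT (EFin \o (g \_ D)).
  have := (@integrable_mkcond _ _ _ mu D (EFin \o g) mD).1 intg.
  by rewrite restrict_EFin.
pose A := [set z : R * R | z.2 <= z.1].
have mA : measurable (A : set (measurableTypeR R * measurableTypeR R)).
  rewrite (_ : A = (fun z : R * R => z.2 <= z.1) @^-1` [set true]); last first.
    by apply/seteqP; split.
  rewrite -[X in measurable X]setTI.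
  exact: measurable_fun_ler.
have swap := @Rintegral_swap _ _ (measurableTypeR R) (measurableTypeR R) R mu mu A _ _ mA inth0 intg0.
rewrite [RHS]Rintegral_mkcond [LHS]Rintegral_mkcond.
transitivity (\int[mu]_x ((h \_ D) x * \int[mu]_y ((g \_ D) y * \1_A (x, y)))).
  apply: eq_Rintegral => x _; rewrite !patchE.
  case: ifPn => [|_]; last by rewrite mul0r.
  rewrite inE /D/= in_itv/= => /andP[x0 xL]; congr (_ * _).
  rewrite Rintegral_mkcond; apply: eq_Rintegral => y _; rewrite !patchE.
  rewrite indicE; have [yx|yx] := boolP (y \in `[0, x]%classic).
    move: yx; rewrite inE/= in_itv/= => /andP[y0 yx].
    have yD : y \in D by rewrite inE /D/= in_itv/= y0 (le_trans yx).
    have yA : (x, y) \in A by rewrite inE.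
    by rewrite yD yA mulr1.
  have [yD|yD] := ifPn; last by rewrite mul0r.
  have [|_] := boolP ((x, y) \in A); last by rewrite mulr0.
  rewrite inE => yx'; move/negP : yx; case.
  by move: yD; rewrite !inE /D/= !in_itv/= => /andP[-> _].
rewrite {}swap; apply: eq_Rintegral => y _; rewrite !patchE.
case: ifPn => [|_]; last by rewrite mul0r.
rewrite inE /D/= in_itv/= => /andP[y0 yL]; congr (_ * _).
(* The difference of integrals lives on ]y, L]. Adding the null endpoint y matches the weak
   inequality that defines [A]. *)
rewrite Rintegral_itvB// ?bnd_simp//.
rewrite Rintegral_itv_obnd_cbnd//; last first.
  by apply: integrableS inth => //; apply: subset_itvr; rewrite bnd_simp.
rewrite [RHS]Rintegral_mkcond; apply: eq_Rintegral => x _; rewrite !patchE.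
rewrite indicE; have [xy|xy] := boolP (x \in `[y, L]%classic).
  move: xy; rewrite inE/= in_itv/= => /andP[yx xL].
  rewrite !mem_set ?mulr1// /D/= in_itv/= xL/= (le_trans y0)//.
have [xD|xD] := ifPn; last by rewrite mul0r.
rewrite memNset ?mulr0// => /= yx; move/negP : xy; apply.
by move: xD; rewrite !inE /D/= !in_itv/= => /andP[_ ->]; rewrite yx.
Qed.

(* Integration by parts when w'' = h is merely integrable: with w' = c + H,
   swapping the integrals turns the left-hand side into - \int w'^2. *)
Lemma dirichlet_form_le0 (c : R) (w h : R -> R) : in_Linf 1 h ->
  (forall x, `[0, 1]%classic x -> w x = c * x +
     \int[mu]_(y in `[0, x]) \int[mu]_(z in `[0, y]) h z) ->
  w 1 = 0 -> \int[mu]_(x in `[0, 1]) (w x * h x) <= 0.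
Proof.
move=> hL wE w1; have inth := in_Linf_integrable hL.
pose H y := \int[mu]_(z in `[0, y]) h z.
have HL : in_Linf 1 H.
  exact/continuous_in_Linf/parameterized_integral_continuous.
pose g y := c + H y.
have gL : in_Linf 1 g by apply: in_LinfD => //; exact: in_Linf_cst.
have intg := in_Linf_integrable gL.
have wg x : `[0, 1]%classic x -> w x = \int[mu]_(y in `[0, x]) g y.
  move=> x01; have := x01; rewrite /= in_itv/= => /andP[x0 x1].
  rewrite RintegralD//=.
  - rewrite wE// Rintegral_cst//= lebesgue_measure_itv/= lte_fin.
    move: x0; rewrite le_eqVlt => /predU1P[<-|->]; last by rewrite oppr0 adde0.
    by rewrite ltxx.
  - apply: integrableS (in_Linf_integrable (in_Linf_cst 1 c)) => //.
    by apply: subset_itvl; rewrite bnd_simp.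
  - apply: integrableS (in_Linf_integrable HL) => //.
    by apply: subset_itvl; rewrite bnd_simp.
(* Since g = w', the boundary values w(0) = w(1) = 0 say that [g] has mean zero. *)
have g0 : \int[mu]_(y in `[0, 1]) g y = 0.
  by rewrite -wg// /= in_itv/= lexx ler01.
have -> : \int[mu]_(x in `[0, 1]) (w x * h x) =
          \int[mu]_(x in `[0, 1]) (h x * \int[mu]_(y in `[0, x]) g y).
  by apply: eq_Rintegral => x; rewrite inE => x01; rewrite mulrC wg.
rewrite Rintegral_swap_triangle// -/(H 1).
(* Substituting H = g - c isolates a constant multiple of [g], which integrates to zero, and leaves
   only the integral of -g^2. *)
have -> : \int[mu]_(y in `[0, 1]) (g y * (H 1 - H y)) =
          \int[mu]_(y in `[0, 1]) ((H 1 + c) * g y - g y * g y).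
  by apply: eq_Rintegral => y _; rewrite /g; ring.
rewrite RintegralB//; last 2 first.
- exact/in_Linf_integrable/in_LinfZ.
- exact/in_Linf_integrable/in_LinfM.
rewrite RintegralZl// g0 mulr0 sub0r oppr_le0.
by apply: Rintegral_ge0 => y _; rewrite -expr2 sqr_ge0.
Qed.

End dirichlet_form.

(** * Twice integrated functions with Dirichlet boundary values *)

Section dirichlet_primitive.
Variable R : realType.
Local Notation mu := (@lebesgue_measure R).
Implicit Types (c : R) (f g h w : R -> R).

(** Integrated form of w'' = h with w(0) = w(1) = 0, suited to an [h] that is only essentially
    bounded. The constant [c] is w'(0), and w(0) = 0 is encoded by the missing constant term. *)
Definition dirichlet_primitive2 w h : Prop :=
  [/\ in_Linf 1 w, in_Linf 1 h, w 1 = 0 &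
   exists c, forall x, `[0, 1]%classic x -> w x = c * x +
     \int[mu]_(y in `[0, x]) \int[mu]_(z in `[0, y]) h z].

Lemma dirichlet_primitive2_cst0 : dirichlet_primitive2 (fun=> 0) (fun=> 0).
Proof.
split; [exact: in_Linf_cst|exact: in_Linf_cst|by []|].
exists 0 => x _; rewrite mul0r add0r.
have -> : (fun y : R => \int[mu]_(z in `[0, y]) 0) = (fun=> 0) :> (R -> R).
  by apply/funext => y; rewrite Rintegral_cst// mul0r.
by rewrite Rintegral_cst// mul0r.
Qed.

Lemma in_Linf_integrable_sub (L : R) f (x : R) : in_Linf L f -> `[0, L]%classic x ->
  mu.-integrable `[0, x] (EFin \o f).
Proof.
move=> /in_Linf_integrable fL; rewrite /= in_itv/= => /andP[x0 x1].
by apply: integrableS fL => //; apply: subset_itvl; rewrite bnd_simp.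
Qed.

Lemma in_Linf_primitive h : in_Linf 1 h ->
  in_Linf 1 (fun y => \int[mu]_(z in `[0, y]) h z).
Proof.
move=> /in_Linf_integrable hL.
exact/continuous_in_Linf/parameterized_integral_continuous.
Qed.

(** This one combination serves both the induction over finite sums and, with k = -1, the difference
    of two sums. *)
Lemma dirichlet_primitive2_lin (k : R) w h w' h' :
  dirichlet_primitive2 w h -> dirichlet_primitive2 w' h' ->
  dirichlet_primitive2 (fun x => k * w x + w' x) (fun x => k * h x + h' x).
Proof.
move=> [wL hL w1 [c wE]] [wL' hL' w1' [c' wE']]; split.
- by apply: in_LinfD => //; exact: in_LinfZ.
- by apply: in_LinfD => //; exact: in_LinfZ.
- by rewrite w1 w1' mulr0 addr0.
- exists (k * c + c') => x x01; rewrite wE// wE'//.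
  have HL := in_Linf_primitive hL; have HL' := in_Linf_primitive hL'.
  have -> : \int[mu]_(y in `[0, x]) \int[mu]_(z in `[0, y]) (k * h z + h' z) =
    \int[mu]_(y in `[0, x]) (k * \int[mu]_(z in `[0, y]) h z +
                              \int[mu]_(z in `[0, y]) h' z).
    apply: eq_Rintegral => y; rewrite inE/= in_itv/= => /andP[y0 yx].
    have y01 : `[0, 1]%classic y.
      by move: x01; rewrite /= !in_itv/= y0 => /andP[_]; exact: le_trans.
    rewrite RintegralD//.
    + by rewrite RintegralZl//; exact: in_Linf_integrable_sub hL y01.
    + exact: in_Linf_integrable_sub (in_LinfZ k hL) y01.
    + exact: in_Linf_integrable_sub hL' y01.
  rewrite RintegralD//.
  + rewrite RintegralZl//; first by ring.
    exact: in_Linf_integrable_sub HL x01.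
  + exact: in_Linf_integrable_sub (in_LinfZ k HL) x01.
  + exact: in_Linf_integrable_sub HL' x01.
Qed.

Lemma dirichlet_primitive2_sum (I : Type) (s : seq I) (b : I -> R)
    (w h : I -> R -> R) : (forall i, dirichlet_primitive2 (w i) (h i)) ->
  dirichlet_primitive2 (fun x => \sum_(i <- s) b i * w i x)
                       (fun x => \sum_(i <- s) b i * h i x).
Proof.
move=> wh; elim: s => [|i s IHs].
  have e (f : I -> R -> R) : (fun x => \sum_(i <- [::]) b i * f i x) = (fun=> 0) :> (R -> R).
    by apply/funext => x; rewrite big_nil.
  by rewrite !e; exact: dirichlet_primitive2_cst0.
have e (f : I -> R -> R) : (fun x => \sum_(j <- i :: s) b j * f j x) =
    (fun x => b i * f i x + \sum_(j <- s) b j * f j x) :> (R -> R).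
  by apply/funext => x; rewrite big_cons.
by rewrite !e; exact: dirichlet_primitive2_lin.
Qed.

Lemma eigenfunction_primitive2 (q : R -> R) lam phi n : in_Linf 1 q ->
  dirichlet_eigensystem q lam phi ->
  dirichlet_primitive2 (phi n) (fun x => (q x - lam n) * phi n x).
Proof.
move=> qL [cphi [ephi [phi1 _]]].
have phiL : in_Linf 1 (phi n) by exact: continuous_in_Linf.
split => //.
by apply: in_LinfM => //; apply: in_LinfB => //; exact: in_Linf_cst.
Qed.

(** The second derivative is displayed as q w minus (-d^2/dx^2 + q) w, because it is the latter term
    that governs the time derivative in the energy argument. *)
Lemma eigensum_primitive2 (q : R -> R) lam phi N (b : nat -> R) : in_Linf 1 q ->
  dirichlet_eigensystem q lam phi ->
  dirichlet_primitive2 (fun x => \sum_(k < N) b k * phi k x)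
   (fun x => q x * (\sum_(k < N) b k * phi k x)
             - \sum_(k < N) b k * lam k * phi k x).
Proof.
move=> qL es.
have := @dirichlet_primitive2_sum _ (index_enum 'I_N) b _ _
  (fun k => eigenfunction_primitive2 k qL es).
congr dirichlet_primitive2; apply/funext => x.
rewrite mulr_sumr -sumrB; apply: eq_bigr => k _; ring.
Qed.

(* Here Lp and Lv stand for (-d^2/dx^2 + q) p and (-d^2/dx^2 + q') v. *)
Lemma energy_dissipation (q q' p v Lp Lv : R -> R) (M dl P al be : R) :
  in_Linf 1 q -> in_Linf 1 q' -> in_Linf 1 Lp -> in_Linf 1 Lv ->
  dirichlet_primitive2 p (fun x => q x * p x - Lp x) ->
  dirichlet_primitive2 v (fun x => q' x * v x - Lv x) ->
  0 <= be -> 0 <= dl ->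
  {ae mu, forall x, `[0, 1]%classic x -> `|q' x| <= M} ->
  {ae mu, forall x, `[0, 1]%classic x -> `|q x - q' x| <= dl} ->
  (forall x, `[0, 1]%classic x -> `|p x| <= P) ->
  (forall x, `[0, 1]%classic x -> `|Lp x| <= P) ->
  \int[mu]_(x in `[0, 1]) (2 * ((p x - v x) * (be * Lv x - al * Lp x))) <=
  (2 * be * M + 1) * \int[mu]_(x in `[0, 1]) ((p x - v x) ^+ 2)
  + ((be * dl + `|be - al|) * P) ^+ 2.
Proof.
move=> qL q'L LpL LvL hp hv be0 dl0 q'M qq' pP LpP.
(* Here w = p - v, and [h] below is its second derivative. *)
have [w_L h_L w1 [c wE]] := dirichlet_primitive2_lin (-1) hv hp.
set w := (fun x => -1 * v x + p x) in w_L w1 wE.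
set h := (fun x => -1 * (q' x * v x - Lv x) + _) in h_L wE.
have wh0 := dirichlet_form_le0 h_L wE w1.
have w2L : in_Linf 1 (fun x => w x ^+ 2).
  by have := in_LinfM w_L w_L; congr in_Linf; apply/funext => x; rewrite expr2.
have whL : in_Linf 1 (fun x => w x * h x) by exact: in_LinfM.
set e2 := _ ^+ 2.
(* The pointwise estimate keeps the term w w'', whose sign is known only after integration. *)
apply: (@le_trans _ _ (\int[mu]_(x in `[0, 1])
   (2 * be * (w x * h x) + ((2 * be * M + 1) * w x ^+ 2 + e2)))).
  apply: ae_le_Rintegral => //.
  - apply/in_Linf_integrable/in_LinfZ/in_LinfM; last first.
      by apply: in_LinfB; exact: in_LinfZ.
    have := w_L; congr in_Linf; apply/funext => x; rewrite /w; ring.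
  - apply/in_Linf_integrable/in_LinfD; first exact: in_LinfZ.
    by apply: in_LinfD; [exact: in_LinfZ|exact: in_Linf_cst].
  apply: filterS2 q'M qq' => x q'M qq' x01.
  have {}q'M := q'M x01; have {}qq' := qq' x01.
  have {}pP := pP _ x01; have {}LpP := LpP _ x01.
  (* The residual of [p] in the equation of [v]: be Lv - al Lp = be (w'' - q' w) + r. It involves
     [p] and [Lp] only, so it is controlled by [P] and by the differences of the coefficients. *)
  pose r := (be - al) * Lp x - be * (q x - q' x) * p x.
  have re : r ^+ 2 <= e2.
    rewrite /e2 -(ger0_norm (sqr_ge0 r)) normrX lerXn2r// ?nnegrE.
      rewrite mulr_ge0 ?(le_trans _ pP)//.
      by rewrite addr_ge0 ?mulr_ge0.
    rewrite (le_trans (ler_normB _ _))// !normrM (ger0_norm be0) mulrDl addrC.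
    by rewrite lerD ?ler_pM ?mulr_ge0// ler_wpM2l.
  have -> : 2 * ((p x - v x) * (be * Lv x - al * Lp x)) =
    2 * be * (w x * h x) - 2 * be * (q' x * w x ^+ 2) + 2 * w x * r.
    by rewrite /r /h /w; ring.
  have q'w : be * - (q' x * w x ^+ 2) <= be * (M * w x ^+ 2).
    rewrite ler_wpM2l// -mulNr ler_wpM2r ?sqr_ge0//.
    by rewrite (le_trans _ q'M)// -normrN ler_norm.
  (* Young's inequality 2 w r <= w^2 + r^2; its w^2 is the source of the 1 in [2 * be * M + 1]. *)
  have wr := sqr_ge0 (w x - r).
  rewrite -addrA lerD2l -subr_ge0.
  rewrite (_ : _ - _ = 2 * (be * (M * w x ^+ 2) - be * - (q' x * w x ^+ 2)) +
    ((w x - r) ^+ 2 + (e2 - r ^+ 2))); last by ring.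
  apply: addr_ge0; first by rewrite mulr_ge0// subr_ge0.
  by apply: addr_ge0 => //; rewrite subr_ge0.
rewrite RintegralD//; last 2 first.
- exact/in_Linf_integrable/in_LinfZ.
- apply/in_Linf_integrable/in_LinfD; last exact: in_Linf_cst.
  exact: in_LinfZ.
rewrite RintegralD//; last 2 first.
- exact/in_Linf_integrable/in_LinfZ.
- exact/in_Linf_integrable/in_Linf_cst.
rewrite RintegralZl//; last exact/in_Linf_integrable.
rewrite RintegralZl//; last exact/in_Linf_integrable.
rewrite Rintegral_cst//= lebesgue_measure_itv/= lte_fin ltr01/= oppr0 addr0 mulr1.
have -> : \int[mu]_(x in `[0, 1]) ((p x - v x) ^+ 2) =
  \int[mu]_(x in `[0, 1]) (w x ^+ 2).
  by apply: eq_Rintegral => x _; rewrite /w; congr (_ ^+ 2); ring.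
(* The integral of w w'' is nonpositive and [be] is nonnegative, so this term is dropped. *)
by rewrite gerDr mulr_ge0_le0// mulr_ge0.
Qed.

End dirichlet_primitive.

(** * Gronwall's inequality and the time derivative of a squared norm *)

Section gronwall.
Variable R : realType.
Local Notation mu := (@lebesgue_measure R).

Lemma is_derive_expR_linear (r s : R) :
  is_derive s 1 (fun t => expR (r * t)) (r * expR (r * s)).
Proof.
have lin : is_derive s 1 (fun t : R => r * t : R^o) (r : R^o).
  have := @is_deriveZ R R R^o id r s 1 _ (is_derive_id _ _).
  by rewrite /GRing.scale/= mulr1.
by rewrite mulrC; exact: (@is_derive1_comp _ expR (fun t => r * t)).
Qed.

(** The function (f + E) exp(-L s) is nonincreasing: its derivative has the sign of f' - L f - L E,
    and E <= L E because L >= 1. Folding [E] into the unknown avoids an integral of the source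
    term. *)
Lemma gronwall_unit_interval (f df : R -> R) (L E : R) : 1 <= L -> 0 <= E ->
  (forall s : R, is_derive s 1 f (df s)) ->
  (forall s, 0 <= s <= 1 -> df s <= L * f s + E) ->
  f 1 <= (f 0 + E) * expR L.
Proof.
move=> L1 E0 fdf dfle.
pose k s := (f s + E) * expR (- L * s).
have kd (s : R) : is_derive s 1 k ((df s - L * (f s + E)) * expR (- L * s)).
  have e1 := is_derive_expR_linear (- L) s.
  have e2 : is_derive s 1 (fun s => f s + E) (df s).
    have := @is_deriveD R R R^o f (cst E) s 1 _ _ (fdf s) (is_derive_cst _ _ _).
    by rewrite addr0.
  apply: (is_derive_eq (is_deriveM e2 e1)).
  by rewrite /GRing.scale/=; ring.
have : k 1 <= k 0.
  apply: (@ler0_derive1_le _ k 0 1 _ _ true false).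
  - by move=> x _; case: (kd x).
  - move=> x; rewrite in_itv/= => /andP[x0 x1].
    rewrite derive1E (@derive_val _ _ _ _ _ _ _ (kd x)) mulr_le0_ge0 ?expR_ge0//.
    rewrite subr_le0 (le_trans (dfle _ _)) ?(ltW x0) ?(ltW x1)//.
    by rewrite mulrDr lerD2l ler_peMl.
  - apply: continuous_subspaceT => x.
    by apply: differentiable_continuous; apply/derivable1_diffP; case: (kd x).
  - by rewrite in_itv/= lexx ler01.
  - by rewrite in_itv/= lexx ler01.
  - exact: ler01.
rewrite /k mulr0 expR0 !mulr1 expRN => k10.
have := ler_wpM2r (expR_ge0 L) k10.
rewrite -mulrA mulVf ?gt_eqF ?expR_gt0// mulr1; apply: le_trans.
by rewrite lerDl.
Qed.

(** Expansion through the Gram matrix of [chi]. No orthogonality is assumed, since two different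
    eigenbases will be mixed in one family. *)
Lemma Rintegral_gram (I : finType) (chi : I -> R -> R) (a b : I -> R) :
  (forall i, in_Linf 1 (chi i)) ->
  \int[mu]_(x in `[0, 1]) ((\sum_i a i * chi i x) * (\sum_j b j * chi j x)) =
  \sum_i \sum_j a i * b j * \int[mu]_(x in `[0, 1]) (chi i x * chi j x).
Proof.
move=> chiL.
have cchiL i j : in_Linf 1 (fun x => chi i x * chi j x) by exact: in_LinfM.
have -> : \int[mu]_(x in `[0, 1])
    ((\sum_i a i * chi i x) * (\sum_j b j * chi j x)) =
  \int[mu]_(x in `[0, 1])
    (\sum_i (\sum_j a i * b j * (chi i x * chi j x))).
  apply: eq_Rintegral => x _; rewrite mulr_suml; apply: eq_bigr => i _.
  by rewrite mulr_sumr; apply: eq_bigr => j _; ring.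
rewrite Rintegral_sum//; last first.
  by move=> i; apply/in_Linf_integrable/in_Linf_sum => j; exact: in_LinfZ.
apply: eq_bigr => i _; rewrite Rintegral_sum//; last first.
  by move=> j; apply/in_Linf_integrable; exact: in_LinfZ.
by apply: eq_bigr => j _; rewrite RintegralZl//; exact: in_Linf_integrable.
Qed.

Lemma is_derive_bigsum (I : finType) (f : I -> R -> R) (df : I -> R) (s : R) :
  (forall i, is_derive s 1 (f i) (df i)) ->
  is_derive s 1 (fun t => \sum_i f i t) (\sum_i df i).
Proof.
move=> fdf; rewrite (_ : (fun t => _) = \sum_i f i); last first.
  by apply/funext => t; rewrite fct_sumE.
by elim/big_ind2 : _ => // [|] *; [exact: is_derive_cst|exact: is_deriveD].
Qed.

(** With the Gram matrix constant in time, the squared norm is a finite quadratic form in the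
    coefficients, so no differentiation under the integral sign occurs. *)
Lemma is_derive_sqr_norm (I : finType) (chi : I -> R -> R)
    (a da : I -> R -> R) (s : R) : (forall i, in_Linf 1 (chi i)) ->
  (forall i, is_derive s 1 (a i) (da i s)) ->
  is_derive s 1 (fun t => \int[mu]_(x in `[0, 1]) (\sum_i a i t * chi i x) ^+ 2)
    (\int[mu]_(x in `[0, 1])
       (2 * ((\sum_i a i s * chi i x) * (\sum_i da i s * chi i x)))).
Proof.
move=> chiL ada.
rewrite (_ : (fun t => _) = (fun t => \sum_i \sum_j
  a i t * a j t * \int[mu]_(x in `[0, 1]) (chi i x * chi j x))); last first.
  apply/funext => t; rewrite -(Rintegral_gram (a^~ t) (a^~ t) chiL).
  by apply: eq_Rintegral => x _; rewrite expr2.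
have sumL (b : I -> R) : in_Linf 1 (fun x => \sum_i b i * chi i x).
  by apply: in_Linf_sum => i; exact: in_LinfZ.
have -> : \int[mu]_(x in `[0, 1])
    (2 * ((\sum_i a i s * chi i x) * (\sum_i da i s * chi i x))) =
  \sum_i \sum_j (a i s * da j s + da i s * a j s) *
    \int[mu]_(x in `[0, 1]) (chi i x * chi j x).
  (* The factor 2 is split into two symmetric copies, which match the two terms of the product rule
     entry by entry. *)
  transitivity (\int[mu]_(x in `[0, 1])
      ((\sum_i a i s * chi i x) * (\sum_i da i s * chi i x)) +
    \int[mu]_(x in `[0, 1])
      ((\sum_i da i s * chi i x) * (\sum_i a i s * chi i x))).
    rewrite -RintegralD//; last 2 first.
    - exact/in_Linf_integrable/in_LinfM.
    - exact/in_Linf_integrable/in_LinfM.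
    by apply: eq_Rintegral => x _; ring.
  rewrite !Rintegral_gram// -big_split/=; apply: eq_bigr => i _.
  by rewrite -big_split/=; apply: eq_bigr => j _; rewrite mulrDl.
apply: is_derive_bigsum => i; apply: is_derive_bigsum => j.
have aa := is_deriveM (ada i) (ada j).
have aac := is_deriveM aa (is_derive_cst
  (\int[mu]_(x in `[0, 1]) (chi i x * chi j x)) s 1).
apply: (is_derive_eq aac).
by rewrite /GRing.scale/=; ring.
Qed.

Lemma is_derive_expR_decay (c r s : R) :
  is_derive s 1 (fun t => c * expR (- r * t)) (c * - r * expR (- r * s)).
Proof.
have := @is_deriveZ R R R^o _ c s 1 _ (is_derive_expR_linear (- r) s).
by rewrite /GRing.scale/= mulrA.
Qed.

End gronwall.

(** * Energy estimate for two finite eigenfunction sums *)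

Section energy_estimate.
Variable R : realType.
Local Notation mu := (@lebesgue_measure R).

(** The clock [s] stands for the accumulated integral of the time coefficient, so s = 0 gives the
    partial sum of the initial datum. Replacing [b k] by [b k * lam k] applies -d^2/dx^2 + q. *)
Definition heat_sum (N : nat) (b lam : nat -> R) (phi : nat -> R -> R)
    (s x : R) : R :=
  \sum_(k < N) b k * expR (- lam k * s) * phi k x.

Lemma in_Linf_heat_sum q N b lam phi s : dirichlet_eigensystem q lam phi ->
  in_Linf 1 (heat_sum N b lam phi s).
Proof.
by move=> [cphi _]; apply: in_Linf_sum => k; exact/in_LinfZ/continuous_in_Linf.
Qed.

(* The exact flows of duration al and be are both rescaled to [0, 1], so that
   they can be compared although they run for different times. *)
Lemma heat_sum_energy_estimate (q q' : R -> R) (lam lam' : nat -> R)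
    (phi psi : nat -> R -> R) N J (b c : nat -> R) (M dl P al be : R) :
  in_Linf 1 q -> in_Linf 1 q' ->
  dirichlet_eigensystem q lam phi -> dirichlet_eigensystem q' lam' psi ->
  0 <= be -> 0 <= dl -> 0 <= M ->
  {ae mu, forall x, `[0, 1]%classic x -> `|q' x| <= M} ->
  {ae mu, forall x, `[0, 1]%classic x -> `|q x - q' x| <= dl} ->
  (forall s x, 0 <= s <= 1 -> `[0, 1]%classic x ->
     `|heat_sum N b lam phi (al * s) x| <= P) ->
  (forall s x, 0 <= s <= 1 -> `[0, 1]%classic x ->
     `|heat_sum N (fun k => b k * lam k) lam phi (al * s) x| <= P) ->
  \int[mu]_(x in `[0, 1])
     (heat_sum N b lam phi al x - heat_sum J c lam' psi be x) ^+ 2 <=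
  (\int[mu]_(x in `[0, 1])
     (heat_sum N b lam phi 0 x - heat_sum J c lam' psi 0 x) ^+ 2
   + ((be * dl + `|be - al|) * P) ^+ 2) * expR (2 * be * M + 1).
Proof.
move=> qL q'L es es' be0 dl0 M0 q'M qq' pP LpP.
have [cphi _] := es; have [cpsi _] := es'.
(* The difference of the two sums becomes one finite sum over a disjoint union of indices; the minus
   sign goes into [a0] and the durations [al], [be] into the rates. *)
pose chi (i : 'I_N + 'I_J) := match i with inl k => phi k | inr j => psi j end.
pose rate (i : 'I_N + 'I_J) :=
  match i with inl k => al * lam k | inr j => be * lam' j end.
pose a0 (i : 'I_N + 'I_J) := match i with inl k => b k | inr j => - c j end.
pose a i s := a0 i * expR (- rate i * s).
pose da i s := a0 i * - rate i * expR (- rate i * s).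
have chiL i : in_Linf 1 (chi i) by case: i => i; apply: continuous_in_Linf; [exact: cphi|exact: cpsi].
pose f s := \int[mu]_(x in `[0, 1]) (\sum_i a i s * chi i x) ^+ 2.
pose df s := \int[mu]_(x in `[0, 1])
       (2 * ((\sum_i a i s * chi i x) * (\sum_i da i s * chi i x))).
have fdf (s : R) : is_derive s 1 f (df s).
  by apply: is_derive_sqr_norm => // i; exact: is_derive_expR_decay.
have aE s x : \sum_i a i s * chi i x =
    heat_sum N b lam phi (al * s) x - heat_sum J c lam' psi (be * s) x.
  rewrite big_sumType/= /heat_sum -sumrN; congr (_ + _); apply: eq_bigr => k _.
    by rewrite /a/= (_ : - (al * lam k) * s = - lam k * (al * s)) //; ring.
  rewrite /a/= (_ : - (be * lam' k) * s = - lam' k * (be * s)); last by ring.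
  by rewrite !mulNr.
have daE s x : \sum_i da i s * chi i x =
    be * heat_sum J (fun k => c k * lam' k) lam' psi (be * s) x -
    al * heat_sum N (fun k => b k * lam k) lam phi (al * s) x.
  rewrite big_sumType/= addrC /heat_sum !mulr_sumr -sumrN.
  congr (_ + _); apply: eq_bigr => k _; rewrite /da/=.
    by rewrite (_ : - (be * lam' k) * s = - lam' k * (be * s)); ring.
  by rewrite (_ : - (al * lam k) * s = - lam k * (al * s)); ring.
have fE s : f s = \int[mu]_(x in `[0, 1])
    (heat_sum N b lam phi (al * s) x - heat_sum J c lam' psi (be * s) x) ^+ 2.
  by apply: eq_Rintegral => x _; rewrite aE.
have := @gronwall_unit_interval R f df (2 * be * M + 1)
  (((be * dl + `|be - al|) * P) ^+ 2) _ _ fdf.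
rewrite !fE !mulr0 !mulr1; apply.
- by rewrite lerDr !mulr_ge0.
- exact: sqr_ge0.
- move=> s s01; rewrite fE /df.
  have -> : \int[mu]_(x in `[0, 1])
       (2 * ((\sum_i a i s * chi i x) * (\sum_i da i s * chi i x))) =
    \int[mu]_(x in `[0, 1]) (2 *
      ((heat_sum N b lam phi (al * s) x - heat_sum J c lam' psi (be * s) x) *
    (be * heat_sum J (fun k => c k * lam' k) lam' psi (be * s) x -
     al * heat_sum N (fun k => b k * lam k) lam phi (al * s) x))).
    by apply: eq_Rintegral => x _; rewrite aE daE.
  apply: (@energy_dissipation _ q q') => //.
  + exact: in_Linf_heat_sum es.
  + exact: in_Linf_heat_sum es'.
  + have := @eigensum_primitive2 _ _ _ _ N
      (fun k => b k * expR (- lam k * (al * s))) qL es.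
    congr dirichlet_primitive2; apply/funext => x; congr (_ - _).
    by apply: eq_bigr => k _; ring.
  + have := @eigensum_primitive2 _ _ _ _ J
      (fun k => c k * expR (- lam' k * (be * s))) q'L es'.
    congr dirichlet_primitive2; apply/funext => x; congr (_ - _).
    by apply: eq_bigr => k _; ring.
  + by move=> x; exact: pP.
  + by move=> x; exact: LpP.
Qed.

End energy_estimate.

(** * Squared L^2 distances *)

Section L2_distance.
Variable R : realType.
Local Notation mu := (@lebesgue_measure R).
Implicit Types (f g m : R -> R) (A B L : R).

Lemma L2sq_in_Linf f : in_Linf 1 f ->
  L2sq 1 f = (\int[mu]_(x in `[0, 1]) f x ^+ 2)%:E.
Proof.
move=> fL; rewrite /L2sq/= integrable_EFin_Rintegral//.
exact: in_Linf_integrable (in_LinfM fL fL).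
Qed.

Lemma L2sq_subC L f g : L2sq L (fun x => f x - g x) = L2sq L (fun x => g x - f x).
Proof.
by apply: eq_integral => x _; rewrite -[f x - g x]opprB sqrrN.
Qed.

(** Triangle inequality for squared norms, from (x + y)^2 <= 2 (x^2 + y^2). It is proved for
    extended reals because [f], [m] and [g] are merely measurable. *)
Lemma L2sq_via m L f g A B :
  measurable_fun `[0, L] f -> measurable_fun `[0, L] m ->
  measurable_fun `[0, L] g ->
  (L2sq L (fun x => f x - m x)%R <= A%:E)%E ->
  (L2sq L (fun x => m x - g x)%R <= B%:E)%E ->
  (L2sq L (fun x => f x - g x)%R <= (2 * (A + B))%:E)%E.
Proof.
move=> mf mm mg fm mg'.
have m1 : measurable_fun `[0, L] (fun x => f x - m x) by exact: measurable_funB.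
have m2 : measurable_fun `[0, L] (fun x => m x - g x) by exact: measurable_funB.
have m3 : measurable_fun `[0, L] (fun x => f x - g x) by exact: measurable_funB.
have sq (k : R -> R) : measurable_fun `[0, L] k ->
    measurable_fun `[0, L] (fun x => ((k x) ^+ 2)%:E).
  by move=> mk; apply/measurable_EFinP; exact: measurable_funX.
have mD : measurable (`[0, L]%classic : set R) by [].
rewrite EFinM (EFinD A).
apply: (@le_trans _ _ (2%:E * (L2sq L (fun x => f x - m x)%R +
                               L2sq L (fun x => m x - g x)%R))%E); last first.
  by apply: lee_wpmul2l => //; exact: leeD.
rewrite /L2sq -ge0_integralD//; last 4 first.
- by move=> x _; rewrite lee_fin sqr_ge0.
- exact: sq.
- by move=> x _; rewrite lee_fin sqr_ge0.
- exact: sq.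
rewrite -ge0_integralZl//; last 2 first.
- by apply: emeasurable_funD; exact: sq.
- by move=> x _; rewrite adde_ge0// lee_fin sqr_ge0.
apply: ge0_le_integral => //.
- by move=> x _; rewrite lee_fin sqr_ge0.
- exact: sq.
- apply: measurable_funeM; by apply: emeasurable_funD; exact: sq.
- move=> x _; rewrite -EFinD -EFinM lee_fin.
  have := sqr_ge0 (f x - m x - (m x - g x)); lra.
Qed.

Lemma cvg0_exists_le (u : nat -> \bar R) (e : R) : 0 < e -> u @ \oo --> 0%E ->
  exists n0, forall n, (n0 <= n)%N -> (u n <= e%:E)%E.
Proof.
move=> e0 u0.
have : \forall n \near \oo, (u n < e%:E)%E.
  have e0' : (0 < e%:E)%E by rewrite lte_fin.
  exact: u0 _ (open_ereal_lt' e0').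
by move=> [n0 _ un0]; exists n0 => n n0n; apply/ltW/un0.
Qed.

End L2_distance.

(** * Time integrals of the coefficient *)

Section time_integral.
Variable R : realType.
Local Notation mu := (@lebesgue_measure R).

(** The bound uses the full length [T] rather than [t], which makes it uniform in time. *)
Lemma norm_Rintegral_le (T K t : R) (f : R -> R) : in_Linf T f -> 0 <= K ->
  {ae mu, forall s, `[0, T]%classic s -> `|f s| <= K} -> `[0, T]%classic t ->
  `|\int[mu]_(s in `[0, t]) f s| <= K * T.
Proof.
move=> fL K0 fK tT; have intf := in_Linf_integrable_sub fL tT.
have := tT; rewrite /= in_itv/= => /andP[t0 tT'].
have T0 := le_trans t0 tT'.
apply: le_trans (le_normr_Rintegral _ intf) _ => //.
apply: (@le_trans _ _ (\int[mu]_(s in `[0, t]) K)).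
  apply: ae_le_Rintegral => //.
  - exact: integrable_norm intf.
  - exact: in_Linf_integrable (in_Linf_cst t K).
  - apply: filterS fK => s fK st; apply: fK.
    by move: st; rewrite /= !in_itv/= => /andP[-> st]; rewrite (le_trans st).
rewrite Rintegral_cst//= lebesgue_measure_itv/= lte_fin.
move: t0; rewrite le_eqVlt => /predU1P[<-|t0].
  by rewrite ltxx mulr0 mulr_ge0.
by rewrite t0/= oppr0 addr0 ler_wpM2l.
Qed.

Lemma ae_ge0_Rintegral_sub (T t : R) (f : R -> R) : in_Linf T f ->
  {ae mu, forall s, `[0, T]%classic s -> 0 <= f s} -> `[0, T]%classic t ->
  0 <= \int[mu]_(s in `[0, t]) f s.
Proof.
move=> fL f0 tT; have intf := in_Linf_integrable_sub fL tT.
apply: ae_ge0_Rintegral => //.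
  by apply/measurable_EFinP; case/integrableP : intf.
apply: filterS f0 => s f0 st; apply: f0.
move: st tT; rewrite /= !in_itv/= => /andP[-> st] /andP[_ tT].
exact: le_trans tT.
Qed.

End time_integral.

(** * Stability of the full series *)

Section heat_sum_stability.
Variable R : realType.
Local Notation mu := (@lebesgue_measure R).

(** At time zero the exponentials equal 1, so this is the completeness of the eigenfunctions. *)
Lemma heat_sum0_cvg (q f lam : _) (phi : nat -> R -> R) :
  in_L2 1 f -> dirichlet_eigensystem q lam phi ->
  (fun n => L2sq 1 (fun x => f x - heat_sum n
    (fun k => \int[mu]_(y in `[0, 1]) (f y * phi k y)) lam phi 0 x))
  @ \oo --> 0%E.
Proof.
move=> fL2 [_ [_ [_ [_ complete]]]].
rewrite (_ : (fun n => _) = (fun n => L2sq 1 (fun x => f x - \sum_(k < n)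
  \int[mu]_(y in `[0, 1]) (f y * phi k y) * phi k x))); first exact: complete.
apply/funext => n; congr L2sq; apply/funext => x; congr (_ - _).
by apply: eq_bigr => k _; rewrite mulr0 expR0 mulr1.
Qed.

(** Each of the finitely many terms is bounded for |s| <= C; the absolute value of [lam] covers
    negative eigenvalues. The bound depends on [N], which is harmless once [N] is fixed. *)
Lemma heat_sum_bounded q N b lam phi (C : R) :
  dirichlet_eigensystem q lam phi ->
  exists2 P : R, 0 <= P & forall s x, `|s| <= C -> `[0, 1]%classic x ->
    `|heat_sum N b lam phi s x| <= P.
Proof.
move=> [cphi _]; elim: N => [|N [P P0 IHP]].
  by exists 0 => // s x _ _; rewrite /heat_sum big_ord0 normr0.
have [K phiK] := continuous_bounded_itv (cphi N).
have K0 : 0 <= K.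
  by apply: le_trans (phiK 0 _) => //=; rewrite in_itv/= lexx ler01.
exists (P + `|b N| * expR (`|lam N| * C) * K).
  by rewrite addr_ge0// !mulr_ge0// expR_ge0.
move=> s x sC x01; rewrite /heat_sum big_ord_recr/=.
apply: le_trans (ler_normD _ _) _; rewrite lerD ?IHP//.
rewrite !normrM ler_pM ?mulr_ge0// ?phiK// ler_wpM2l//.
rewrite ger0_norm ?expR_ge0// ler_expR (le_trans (ler_norm _))//.
by rewrite normrM normrN ler_wpM2l.
Qed.

(** Energy estimate with p = 0 and equal coefficients, so that the error term vanishes. The growth
    factor comes from the bound on [q], and does not depend on [N] or [N']. *)
Lemma heat_sum_tail q lam phi (b : nat -> R) N N' (M al : R) :
  in_Linf 1 q -> dirichlet_eigensystem q lam phi -> (N <= N')%N ->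
  0 <= al -> 0 <= M ->
  {ae mu, forall x, `[0, 1]%classic x -> `|q x| <= M} ->
  \int[mu]_(x in `[0, 1])
     (heat_sum N' b lam phi al x - heat_sum N b lam phi al x) ^+ 2 <=
  \int[mu]_(x in `[0, 1])
     (heat_sum N' b lam phi 0 x - heat_sum N b lam phi 0 x) ^+ 2
  * expR (2 * al * M + 1).
Proof.
move=> qL es NN' al0 M0 qM.
(* Zeroing the first [N] coefficients presents the tail as a sum of length [N'] without shifting
   indices. *)
pose c k := if (k < N)%N then 0 else b k.
have E s x : (heat_sum N' b lam phi s x - heat_sum N b lam phi s x) ^+ 2 =
  (heat_sum 0 b lam phi s x - heat_sum N' c lam phi s x) ^+ 2.
  rewrite {3}/heat_sum big_ord0 sub0r sqrrN; congr (_ ^+ 2).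
  rewrite /heat_sum (big_ord_widen N'
    (fun k => b k * expR (- lam k * s) * phi k x) NN').
  rewrite [X in _ - X]big_mkcond -sumrB; apply: eq_bigr => k _.
  by rewrite /c; case: ifP => _; rewrite ?subrr ?mul0r ?subr0.
under eq_Rintegral do rewrite E; under [in leRHS]eq_Rintegral do rewrite E.
have := @heat_sum_energy_estimate R q q lam lam phi phi 0 N' b c M 0 0 al al
  qL qL es es al0 (lexx 0) M0 qM.
rewrite mulr0 expr0n/= addr0; apply.
- by apply: aeW => x _; rewrite subrr normr0.
- by move=> s x _ _; rewrite /heat_sum big_ord0 normr0.
- by move=> s x _ _; rewrite /heat_sum big_ord0 normr0.
Qed.

(** The chain runs from [u] to its sum of length [N'], then to its sum of length [N], then to a sum
    of length [J] for the other equation, then to [v]. Only [N] enters the hypotheses on [P], so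
    [N'] and [J] may depend on the time considered. *)
Lemma heat_flow_stability (q q' : R -> R) lam lam' phi psi
    (b c : nat -> R) (u0 v0 u v : R -> R) N (M dl P al be eta L : R) :
  in_Linf 1 q -> in_Linf 1 q' ->
  dirichlet_eigensystem q lam phi -> dirichlet_eigensystem q' lam' psi ->
  0 <= al -> 0 <= be -> 0 <= dl -> 0 <= M -> 0 < eta ->
  {ae mu, forall x, `[0, 1]%classic x -> `|q x| <= M} ->
  {ae mu, forall x, `[0, 1]%classic x -> `|q' x| <= M} ->
  {ae mu, forall x, `[0, 1]%classic x -> `|q x - q' x| <= dl} ->
  (forall s x, 0 <= s <= 1 -> `[0, 1]%classic x ->
     `|heat_sum N b lam phi (al * s) x| <= P) ->
  (forall s x, 0 <= s <= 1 -> `[0, 1]%classic x ->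
     `|heat_sum N (fun k => b k * lam k) lam phi (al * s) x| <= P) ->
  2 * al * M + 1 <= L -> 2 * be * M + 1 <= L ->
  ((be * dl + `|be - al|) * P) ^+ 2 <= eta ->
  measurable_fun `[0, 1 : R] u0 -> measurable_fun `[0, 1 : R] v0 ->
  measurable_fun `[0, 1 : R] u -> measurable_fun `[0, 1 : R] v ->
  (L2sq 1 (fun x => u0 x - heat_sum N b lam phi 0 x)%R <= eta%:E)%E ->
  (L2sq 1 (fun x => u0 x - v0 x)%R <= eta%:E)%E ->
  (fun n => L2sq 1 (fun x => u0 x - heat_sum n b lam phi 0 x)) @ \oo --> 0%E ->
  (fun n => L2sq 1 (fun x => v0 x - heat_sum n c lam' psi 0 x)) @ \oo --> 0%E ->
  (fun n => L2sq 1 (fun x => u x - heat_sum n b lam phi al x)) @ \oo --> 0%E ->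
  (fun n => L2sq 1 (fun x => v x - heat_sum n c lam' psi be x)) @ \oo --> 0%E ->
  (L2sq 1 (fun x => u x - v x)%R <= (68 * eta * expR L)%:E)%E.
Proof.
move=> qL q'L es es' al0 be0 dl0 M0 eta0 qM q'M qq' pP LpP alL beL eps
  mu0 mv0 mu_ mv u0N u0v0 cu0 cv0 cu cv.
have [n1 u0n] := cvg0_exists_le eta0 cu0.
have [n2 un] := cvg0_exists_le eta0 cu.
have [n3 v0n] := cvg0_exists_le eta0 cv0.
have [n4 vn] := cvg0_exists_le eta0 cv.
(* Each length must serve both at time zero and at the final clock value; [N'] must also be at least
   [N] for the tail estimate. *)
pose N' := maxn N (maxn n1 n2); pose J := maxn n3 n4.
have n1N' : (n1 <= N')%N by rewrite !leq_max leqnn orbT.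
have n2N' : (n2 <= N')%N by rewrite !leq_max leqnn !orbT.
have n3J : (n3 <= J)%N by rewrite leq_max leqnn.
have n4J : (n4 <= J)%N by rewrite leq_max leqnn orbT.
have {}u0n := u0n _ n1N'; have {}un := un _ n2N'.
have {}v0n := v0n _ n3J; have {}vn := vn _ n4J.
have NN' : (N <= N')%N by rewrite /N' leq_max leqnn.
have hL n s : in_Linf 1 (heat_sum n b lam phi s) := in_Linf_heat_sum n b s es.
have hL' n s : in_Linf 1 (heat_sum n c lam' psi s) := in_Linf_heat_sum n c s es'.
have mh n s : measurable_fun `[0, 1 : R] (heat_sum n b lam phi s) := (hL n s).1.
have mh' n s : measurable_fun `[0, 1 : R] (heat_sum n c lam' psi s) := (hL' n s).1.
have E1 : 1 <= expR L.
  rewrite -expR0 ler_expR (le_trans _ alL)// addr_ge0// !mulr_ge0//.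
have tail0 : \int[mu]_(x in `[0, 1])
    (heat_sum N' b lam phi 0 x - heat_sum N b lam phi 0 x) ^+ 2 <=
    2 * (eta + eta).
  rewrite -lee_fin -L2sq_in_Linf; last exact: in_LinfB.
  by apply: (@L2sq_via _ u0) => //; rewrite L2sq_subC.
have mid0 : \int[mu]_(x in `[0, 1])
    (heat_sum N b lam phi 0 x - heat_sum J c lam' psi 0 x) ^+ 2 <=
    2 * (2 * (eta + eta) + eta).
  rewrite -lee_fin -L2sq_in_Linf; last exact: in_LinfB.
  apply: (@L2sq_via _ v0) => //.
  by apply: (@L2sq_via _ u0) => //; rewrite L2sq_subC.
have tail : (L2sq 1 (fun x => heat_sum N' b lam phi al x -
    heat_sum N b lam phi al x)%R <= (2 * (eta + eta) * expR L)%:E)%E.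
  rewrite L2sq_in_Linf ?lee_fin; last exact: in_LinfB.
  apply: le_trans (heat_sum_tail b qL es NN' al0 M0 qM) _.
  rewrite ler_pM ?expR_ge0 ?ler_expR//.
  by apply: Rintegral_ge0 => x _; rewrite sqr_ge0.
have mid : (L2sq 1 (fun x => heat_sum N b lam phi al x -
    heat_sum J c lam' psi be x)%R <=
    ((2 * (2 * (eta + eta) + eta) + eta) * expR L)%:E)%E.
  rewrite L2sq_in_Linf ?lee_fin; last exact: in_LinfB.
  apply: le_trans (heat_sum_energy_estimate J c qL q'L es es' be0 dl0 M0 q'M
    qq' pP LpP) _.
  rewrite ler_pM ?expR_ge0 ?ler_expR ?lerD//.
  by rewrite addr_ge0 ?sqr_ge0//; apply: Rintegral_ge0 => x _; rewrite sqr_ge0.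
have left_half := L2sq_via mu_ (mh N' al) (mh N al) un tail.
rewrite L2sq_subC in vn.
have right_half := L2sq_via (mh N al) (mh' J be) mv mid vn.
apply: le_trans (L2sq_via mu_ (mh N al) mv left_half right_half) _.
rewrite lee_fin.
(* With X = exp(L), the halves are 2 (eta + 4 eta X) and 2 (11 eta X + eta). Doubling their sum
   gives 8 eta + 60 eta X, at most 68 eta X as X >= 1. *)
have : eta * 1 <= eta * expR L by rewrite ler_wpM2l// ltW.
lra.
Qed.

End heat_sum_stability.

(** * Choice of parameters and convergence uniform in time *)

Theorem theorem5 (R : realType) (T a0 : R) (q a u0 : R -> R)
  (u : R -> R -> R)
  (qe ae u0e : R -> R -> R) (ue : R -> R -> R -> R) :
  0 < T -> 0 < a0 ->
  in_Linf 1 q -> in_Linf T a ->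
  {ae (@lebesgue_measure R), forall t : R, `[0, T]%classic t -> a0 <= a t} ->
  in_L2 1 u0 -> in_H2 u0 ->
  classical_solution T q a u0 u ->
  (forall e : R, 0 < e -> in_Linf 1 (qe e) /\ in_Linf T (ae e) /\ in_L2 1 (u0e e)) ->
  (forall d : R, 0 < d -> \forall e \near 0^'+,
     (L2sq 1 (fun x => (u0 x - u0e e x)%R) <= d%:E)%E) ->
  (forall d : R, 0 < d -> \forall e \near 0^'+,
     {ae (@lebesgue_measure R), forall x : R, `[0, 1]%classic x -> `|q x - qe e x| <= d}) ->
  (forall d : R, 0 < d -> \forall e \near 0^'+,
     {ae (@lebesgue_measure R), forall t : R, `[0, T]%classic t -> `|a t - ae e t| <= d}) ->
  (\forall e \near 0^'+, classical_solution T (qe e) (ae e) (u0e e) (ue e)) ->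
  forall d : R, 0 < d -> \forall e \near 0^'+, forall t : R, `[0, T]%classic t ->
     (L2sq 1 (fun x => (u t x - ue e t x)%R) <= d%:E)%E.
Proof.
move=> T0 a00 qL aL age [mu0 u0L] _ [lam [phi [es usol]]] reg u0cvg qcvg acvg
  uesol d d0.
have [_ [Mq0 qMq0]] := qL; have [_ [Ma0 aMa0]] := aL.
pose Mq := `|Mq0|; pose Ma := `|Ma0|.
have qMq : {ae lebesgue_measure, forall x : R, `[0, 1]%classic x -> `|q x| <= Mq}.
  by apply: filterS qMq0 => x h x01; rewrite (le_trans (h x01))// ler_norm.
have aMa : {ae lebesgue_measure, forall t : R, `[0, T]%classic t -> `|a t| <= Ma}.
  by apply: filterS aMa0 => t h tT; rewrite (le_trans (h tT))// ler_norm.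
(* Once the perturbations are at most 1, [M] bounds both potentials, [C] bounds both clocks for
   every t, and [L] dominates both Gronwall exponents. *)
pose M := Mq + 1; pose C := (Ma + 1) * T; pose L := 2 * C * M + 1.
have Mq0' : 0 <= Mq by exact: normr_ge0.
have Ma0' : 0 <= Ma by exact: normr_ge0.
have M0 : 0 <= M by rewrite addr_ge0.
have C0 : 0 <= C by rewrite mulr_ge0 ?addr_ge0// ltW.
pose eta := d / (68 * expR L).
have eta0 : 0 < eta by rewrite divr_gt0// mulr_gt0// expR_gt0.
pose b k := Rintegral lebesgue_measure `[0, 1] (fun y => u0 y * phi k y).
have cu0 := heat_sum0_cvg (conj mu0 u0L) es.
(* [N] is fixed by the initial datum alone, before [e] and [t]; hence the bound [P] below is
   independent of both. *)
have [N u0N] := cvg0_exists_le eta0 cu0.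
have {}u0N := u0N N (leqnn N).
have [P1 P10 pP] := heat_sum_bounded N b C es.
have [P2 P20 LpP] := heat_sum_bounded N (fun k => b k * lam k) C es.
pose P := P1 + P2.
have P0 : 0 <= P by rewrite addr_ge0.
(* The residual is at most dl (C + T) P; the added 1 makes the divisor positive. *)
pose kap := (C + T) * P + 1.
have kap0 : 0 < kap by rewrite ltr_wpDl// mulr_ge0// addr_ge0// ltW.
(* A residual r <= m satisfies r^2 <= m <= eta, because m <= 1. *)
pose m := Num.min eta 1.
have m0 : 0 < m by rewrite lt_min eta0 ltr01.
(* The bound 1 keeps [M] and [C] valid for the perturbed data, [a0] keeps the perturbed time
   coefficient nonnegative, and [m / kap] makes the residual small. *)
pose dl := Num.min (Num.min 1 a0) (m / kap).
have dl0 : 0 < dl by rewrite !lt_min ltr01 a00/= divr_gt0.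
have dl1 : dl <= 1 by rewrite !ge_min lexx.
have dla0 : dl <= a0 by rewrite !ge_min lexx !orbT.
have dlm : dl * kap <= m by rewrite -ler_pdivlMr// ge_min lexx orbT.
(* [e] is introduced before [t], so one threshold serves all times in [0, T]. *)
near=> e.
have e0 : 0 < e by near: e; exact: nbhs_right_gt.
have [q'L [a'L [mv0 v0L]]] := reg e e0.
have u0v0 : (L2sq 1 (fun x => (u0 x - u0e e x)%R) <= eta%:E)%E.
  by near: e; exact: u0cvg.
have qq' : {ae lebesgue_measure, forall x : R, `[0, 1]%classic x ->
    `|q x - qe e x| <= dl} by near: e; exact: qcvg.
have aa' : {ae lebesgue_measure, forall t : R, `[0, T]%classic t ->
    `|a t - ae e t| <= dl} by near: e; exact: acvg.
have [lam' [psi [es' vsol]]] :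
    classical_solution T (qe e) (ae e) (u0e e) (ue e) by near: e; exact: uesol.
move=> t tT.
have [mu_ cu] := usol t tT; have [mv cv] := vsol t tT.
have cv0 := heat_sum0_cvg (conj mv0 v0L) es'.
pose al := Rintegral lebesgue_measure `[0, t] a.
pose be := Rintegral lebesgue_measure `[0, t] (ae e).
have al0 : 0 <= al.
  apply: (ae_ge0_Rintegral_sub aL _ tT).
  by apply: filterS age => s h sT; rewrite (le_trans (ltW a00))// h.
(* From a >= a0 and |a - ae e| <= dl <= a0, the perturbed coefficient is nonnegative almost
   everywhere. *)
have be0 : 0 <= be.
  apply: (ae_ge0_Rintegral_sub a'L _ tT).
  apply: filterS2 age aa' => s h1 h2 sT; have {}h1 := h1 sT; have {}h2 := h2 sT.
  move: h2; rewrite ler_norml => /andP[_]; rewrite lerBlDr => h2.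
  by rewrite -(lerD2l a0) addr0 (le_trans h1)// (le_trans h2)// lerD2r.
have albe : `|be - al| <= dl * T.
  rewrite distrC /al /be -RintegralB//; last 2 first.
  - exact: in_Linf_integrable_sub aL tT.
  - exact: in_Linf_integrable_sub a'L tT.
  apply: (norm_Rintegral_le _ (ltW dl0) aa' tT).
  exact: in_LinfB.
have alMa : al <= Ma * T.
  by rewrite (le_trans (ler_norm _))//; exact: norm_Rintegral_le aL _ aMa tT.
have alC : al <= C by rewrite (le_trans alMa)// ler_wpM2r ?(ltW T0)// lerDl.
have beC : be <= C.
  (* The clock difference is at most dl T <= T, the summand that [C] adds to Ma T. *)
  rewrite -(subrK al be) /C mulrDl mul1r addrC lerD// (le_trans (ler_norm _))//.
  by rewrite (le_trans albe)// ler_piMl// ltW.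
have q'M : {ae lebesgue_measure, forall x : R, `[0, 1]%classic x ->
    `|qe e x| <= M}.
  apply: filterS2 qMq qq' => x h1 h2 x01.
  rewrite -[qe e x](subKr (q x)) (le_trans (ler_normB _ _))// lerD ?h1//.
  by rewrite (le_trans (h2 x01)).
have qM : {ae lebesgue_measure, forall x : R, `[0, 1]%classic x -> `|q x| <= M}.
  by apply: filterS qMq => x h x01; rewrite (le_trans (h x01))// lerDl.
have als s : 0 <= s <= 1 -> `|al * s| <= C.
  move=> /andP[s0 s1]; rewrite ger0_norm ?mulr_ge0//.
  by rewrite (le_trans _ alC)// ler_piMr.
have pP' s x : 0 <= s <= 1 -> `[0, 1]%classic x ->
    `|heat_sum N b lam phi (al * s) x| <= P.
  by move=> s01 x01; rewrite (le_trans (pP _ _ (als _ s01) x01))// lerDl.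
have LpP' s x : 0 <= s <= 1 -> `[0, 1]%classic x ->
    `|heat_sum N (fun k => b k * lam k) lam phi (al * s) x| <= P.
  by move=> s01 x01; rewrite (le_trans (LpP _ _ (als _ s01) x01))// lerDr.
have alL : 2 * al * M + 1 <= L by rewrite lerD2r ler_wpM2r// ler_wpM2l.
have beL : 2 * be * M + 1 <= L by rewrite lerD2r ler_wpM2r// ler_wpM2l.
have eps : ((be * dl + `|be - al|) * P) ^+ 2 <= eta.
  set r := _ * P.
  have r0 : 0 <= r by rewrite mulr_ge0// addr_ge0// mulr_ge0// ltW.
  have rm : r <= m.
    apply: le_trans dlm; rewrite /kap mulrDr mulr1 ler_wpDr ?(ltW dl0)//.
    by rewrite mulrA ler_wpM2r// mulrDr lerD// mulrC ler_wpM2l// ltW.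
  rewrite expr2 (@le_trans _ _ (m * 1))//.
    by rewrite ler_pM// (le_trans rm)// ge_min lexx orbT.
  by rewrite mulr1 ge_min lexx.
have -> : d = 68 * eta * expR L.
  by rewrite /eta; field; rewrite gt_eqF ?expR_gt0.
exact: (heat_flow_stability qL q'L es es' al0 be0 (ltW dl0) M0 eta0 qM q'M qq'
  pP' LpP' alL beL eps mu0 mv0 mu_ mv u0N u0v0 cu0 cv0 cu cv).
Unshelve. all: by end_near.
Qed.
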